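(* For each positive integer $h$ let $M=M(h)$ be an integer with $2\leq M$ and $M(h)=o(h/\log h)$. For every positive integer $d$ and every $\epsilon\in(0,1)$ there exists $h_0\in\mathbb{N}$ such that the following holds for all $h\geq h_0$. Let $r^*:=\sqrt{d}/(2h)$ and $r:=(1+\epsilon)r^*$. For each $s\in\{2,\dots,M\}$, let $k_s$ be the smallest integer satisfying both $\sqrt{d}\,s^{1-k_s}\leq r$ and $\sqrt{d}\,s^{-k_s}<\epsilon r^*/8$, and let $\mathcal{W}_s$ be the tessellation of $[0,1]^d$ into $s^{k_s d}$ congruent closed axis-parallel cubes. Let $m':=d\,k_2\,M$ (for $h\geq h_0$ one has $m'\leq h$). Let $(s_i)_{i=1}^h$ be a sequence with $s_i\in\{2,\dots,M\}$, let $T$ be the balanced tree over $(s_i)_{i=1}^h$, and let $s\in\{2,\dots,M\}$ be an integer appearing at least $d k_2$ times among $s_1,\dots,s_{m'}$ (such an integer exists by the pigeonhole principle). Let $\mathcal{X}\subseteq[0,1]^d\setminus\partial\mathcal{W}_s$ be a set of $|T|$ points such that every cube $q\in\mathcal{W}_s$ contains a number of points of $\mathcal{X}$ lying in the interval $[s^{-k_s d}|T|-|T|^{2/3},\ s^{-k_s d}|T|+|T|^{2/3}]$. Then $G(\mathcal{X},(1+\epsilon)r^*,d)$ contains a copy of $T$.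
   Context: For a finite set $\mathcal{X}\subseteq[0,1]^d$, the geometric graph $G(\mathcal{X},\rho,d)$ has vertex set $\mathcal{X}$ and edges $xy$ for distinct $x,y\in\mathcal{X}$ with Euclidean distance at most $\rho$. $\partial\mathcal{W}_s$ denotes the union of the topological boundaries of the cubes in $\mathcal{W}_s$. $|T|$ is the number of vertices of $T$. For a rooted tree, the layer $V_i$ is the set of vertices at graph distance $i$ from the root, the height is the largest $h$ with $V_h$ nonempty, and the children of a vertex in $V_j$ are its neighbours in $V_{j+1}$. The balanced tree over $(s_i)_{i=1}^h$ is the rooted tree of height $h$ in which, for each $i\in\{1,\dots,h\}$, every vertex of $V_{i-1}$ has exactly $s_i$ children. *)

(* Defs.v *)
From Stdlib Require Import Reals Lra Lia List.
Import ListNotations.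
Open Scope R_scope.

Fixpoint sqdist (x y : list R) : R :=
  match x, y with
  | a :: x', b :: y' => (a - b) ^ 2 + sqdist x' y'
  | _, _ => 0
  end.

Definition dist (x y : list R) : R := sqrt (sqdist x y).

Definition in_unit_cube (d : nat) (x : list R) : Prop :=
  length x = d /\ Forall (fun a => 0 <= a <= 1) x.

Definition G_adj (X : list (list R)) (rho : R) (x y : list R) : Prop :=
  In x X /\ In y X /\ x <> y /\ dist x y <= rho.

(* ---------- Balanced tree over (s_i)_{i=1}^h ----------
   A vertex at layer j is the list [a_1; ...; a_j] with a_i < s_i
   (the path of child-choices from the root []).  The children of v in
   layer j are v ++ [a] with a < s_(j+1). *)

Fixpoint level (s : nat -> nat) (j : nat) : list (list nat) :=
  match j with
  | O => [ [] ]
  | S j' => flat_map (fun v => map (fun a => v ++ [a]) (seq 0 (s (S j'))))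
                     (level s j')
  end.

Definition btree_vertices (s : nat -> nat) (h : nat) : list (list nat) :=
  flat_map (level s) (seq 0 (S h)).

Definition btree_size (s : nat -> nat) (h : nat) : nat :=
  length (btree_vertices s h).

Definition tree_adj (u v : list nat) : Prop := exists a, v = u ++ [a].

Definition contains_copy_of_btree (X : list (list R)) (rho : R)
    (s : nat -> nat) (h : nat) : Prop :=
  exists f : list nat -> list R,
    (forall u, In u (btree_vertices s h) -> In (f u) X) /\
    (forall u v, In u (btree_vertices s h) -> In v (btree_vertices s h) ->
        f u = f v -> u = v) /\
    (forall u v, In u (btree_vertices s h) -> In v (btree_vertices s h) ->
        tree_adj u v -> G_adj X rho (f u) (f v)).

(* ---------- Tessellation W_s of [0,1]^d into s^(k d) cubes ----------
   A cube is indexed by j = [j_1; ...; j_d] with 0 <= j_i < s^k; it is the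
   closed box  prod_i [j_i s^-k, (j_i + 1) s^-k]. *)

Definition cube_index (d s k : nat) (j : list nat) : Prop :=
  length j = d /\ Forall (fun ji => (ji < s ^ k)%nat) j.

Definition side (s k : nat) : R := / INR (s ^ k).

Definition in_closed_cube (s k : nat) (j : list nat) (x : list R) : Prop :=
  Forall2 (fun ji xi => INR ji * side s k <= xi <= (INR ji + 1) * side s k) j x.

Definition in_open_cube (s k : nat) (j : list nat) (x : list R) : Prop :=
  Forall2 (fun ji xi => INR ji * side s k < xi < (INR ji + 1) * side s k) j x.

Definition on_boundary (d s k : nat) (x : list R) : Prop :=
  exists j, cube_index d s k j /\ in_closed_cube s k j x /\ ~ in_open_cube s k j x.

Definition Rle_b (a b : R) : bool := if Rle_dec a b then true else false.

Fixpoint in_closed_cube_b (sd : R) (j : list nat) (x : list R) : bool :=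
  match j, x with
  | [], [] => true
  | ji :: j', xi :: x' =>
      Rle_b (INR ji * sd) xi && Rle_b xi ((INR ji + 1) * sd)
      && in_closed_cube_b sd j' x'
  | _, _ => false
  end.

Definition count_in_cube (s k : nat) (j : list nat) (X : list (list R)) : nat :=
  length (filter (in_closed_cube_b (side s k) j) X).

Definition rstar (d h : nat) : R := sqrt (INR d) / (2 * INR h).

Definition ks_cond (d h : nat) (eps : R) (s k : nat) : Prop :=
  sqrt (INR d) * INR s / INR (s ^ k) <= (1 + eps) * rstar d h /\
  sqrt (INR d) / INR (s ^ k) < eps * rstar d h / 8.

Definition is_ks (d h : nat) (eps : R) (s k : nat) : Prop :=
  ks_cond d h eps s k /\ (forall k', ks_cond d h eps s k' -> (k <= k')%nat).

Definition occurrences (seqs : nat -> nat) (m v : nat) : nat :=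
  length (filter (fun i => Nat.eqb (seqs i) v) (seq 1 m)).

(* Main.v *)
(** Order the N = m^d cubes along a snake-like curve in which consecutive cubes
    share a face, and identify a vertex of the tree with its depth j and its
    rank t < P_j in layer j, where P_j = s_1 ... s_j.  Its target is the cube
    with index floor(t N / P_j).  As soon as P_j >= N, passing to a child moves
    the target by at most one step of the curve, and in each layer the targets
    are equidistributed up to one vertex per cube.  A vertex that is not a leaf
    goes to the cube containing the point on the segment from the centre of
    [0,1]^d to the centre of its target with parameter lam_j, where lam_j is 0
    while j <= eps h / 12, then grows linearly with slope (1 + eps/2) / h, and
    equals 1 from about (1 - eps/4) h on.  Hence the cubes of adjacent vertices
    are close, and only the few vertices in the upper layers may be badly
    distributed.  The places left free are then given to the leaves in the order
    of the curve.  Numbers of free places per cube deviate from P_h / N by a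
    quantity exponentially smaller than P_h, while N is polynomial in h, so every
    leaf lands within two steps of the cube of its parent. *)

Require Import Defs.
From Stdlib Require Import Reals List Lra Lia Psatz Arith ZArith Classical.
Import ListNotations.
Open Scope R_scope.

(** * Counting and matching *)

Definition count {A : Type} (f : A -> bool) (l : list A) : nat := length (filter f l).

Lemma count_app {A} (f : A -> bool) l l' : count f (l ++ l') = (count f l + count f l')%nat.
Proof. unfold count. now rewrite filter_app, length_app. Qed.

Lemma count_cons {A} (f : A -> bool) a l :
  count f (a :: l) = ((if f a then 1 else 0) + count f l)%nat.
Proof. unfold count. simpl. now destruct (f a). Qed.

Lemma count_nil {A} (f : A -> bool) : count f [] = 0%nat.
Proof. easy. Qed.

Lemma count_map {A B} (g : A -> B) (f : B -> bool) l :
  count f (map g l) = count (fun a => f (g a)) l.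
Proof.
  induction l as [|a l IH]; [easy|].
  simpl map. now rewrite !count_cons, IH.
Qed.

Lemma count_ext {A} (f g : A -> bool) l :
  (forall a, In a l -> f a = g a) -> count f l = count g l.
Proof. intros H. unfold count. now rewrite (filter_ext_in f g l H). Qed.

Lemma count_le_length {A} (f : A -> bool) l : (count f l <= length l)%nat.
Proof. apply filter_length_le. Qed.

Lemma count_le {A} (f g : A -> bool) l :
  (forall a, In a l -> f a = true -> g a = true) -> (count f l <= count g l)%nat.
Proof.
  induction l as [|a l IH]; intros H; [easy|].
  rewrite !count_cons.
  assert (count f l <= count g l)%nat by (apply IH; intros; apply H; simpl; auto).
  specialize (H a (or_introl eq_refl)).
  destruct (f a); [rewrite H by easy|destruct (g a)]; lia.
Qed.

(** A matching in which each [b] fits at most one key, so Hall's condition reduces to one count per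
    key and a greedy choice works: spending [b] on [v] lowers the supply of the key of [v] only.
    [b0] merely fills in the function when [LA] is empty. *)
Lemma keyed_injection {A B : Type} (eqA : forall x y : A, {x = y} + {x <> y})
    (b0 : B) (key : A -> nat) (fits : nat -> B -> bool) (N : nat) (LA : list A) (LB : list B) :
  NoDup LB ->
  (forall b i j, In b LB -> (i < N)%nat -> (j < N)%nat ->
     fits i b = true -> fits j b = true -> i = j) ->
  (forall a, In a LA -> (key a < N)%nat) ->
  (forall i, (i < N)%nat ->
     (count (fun a => Nat.eqb (key a) i) LA <= count (fits i) LB)%nat) ->
  exists f : A -> B,
    (forall a, In a LA -> In (f a) LB /\ fits (key a) (f a) = true) /\
    (forall a a', In a LA -> In a' LA -> f a = f a' -> a = a').
Proof.
  revert LB. induction LA as [|v LA IH]; intros LB Hnd Hun Hkey Hcnt.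
  - exists (fun _ => b0). split; intros; easy.
  - assert (Hv : (key v < N)%nat) by (apply Hkey; simpl; auto).
    pose proof (Hcnt _ Hv) as Hc. rewrite count_cons, Nat.eqb_refl in Hc.
    assert (exists b, In b LB /\ fits (key v) b = true) as [b [Hb Hfb]].
    { unfold count in Hc at 2.
      destruct (filter (fits (key v)) LB) as [|b l] eqn:E; [simpl in Hc; lia|].
      exists b. apply filter_In. rewrite E. simpl; auto. }
    destruct (in_split _ _ Hb) as [l1 [l2 ->]].
    edestruct (IH (l1 ++ l2)) as [f [Hf Hinj]].
    + apply NoDup_remove_1 in Hnd. exact Hnd.
    + intros b' i j Hin. apply Hun. rewrite in_app_iff in *. simpl. tauto.
    + intros a Ha. apply Hkey. simpl; auto.
    + intros i Hi. specialize (Hcnt i Hi).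
      rewrite count_cons, count_app, count_cons in Hcnt. rewrite count_app.
      destruct (Nat.eqb_spec (key v) i) as [Heq|Hne].
      * rewrite <- Heq in *. rewrite Hfb in Hcnt. lia.
      * destruct (fits i b) eqn:E; [|lia].
        exfalso. apply Hne. now apply (Hun b).
    + apply NoDup_remove_2 in Hnd.
      exists (fun a => if eqA a v then b else f a). split.
      * intros a Ha. destruct (eqA a v) as [->|Hav]; [now split|].
        destruct Ha as [->|Ha]; [easy|].
        destruct (Hf a Ha) as [H1 H2]. split; [|easy].
        rewrite in_app_iff in *. simpl. tauto.
      * intros a a' Ha Ha'.
        destruct (eqA a v) as [->|Hav], (eqA a' v) as [->|Hav']; intros E; [easy| | |].
        -- destruct Ha' as [->|Ha']; [easy|]. subst b. now destruct (Hf a' Ha').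
        -- destruct Ha as [->|Ha]; [easy|]. subst b. now destruct (Hf a Ha).
        -- destruct Ha as [->|Ha]; [easy|]. destruct Ha' as [->|Ha']; [easy|].
           now apply Hinj.
Qed.

Fixpoint psum (b : nat -> nat) (n : nat) : nat :=
  match n with O => O | S n' => (psum b n' + b n')%nat end.

(* For [t < psum b n], the block containing [t] when [0, psum b n) is cut into
   consecutive blocks of lengths [b 0], ..., [b (n - 1)]. *)
Fixpoint slot (b : nat -> nat) (n t : nat) : nat :=
  match n with
  | O => O
  | S n' => if (t <? psum b n')%nat then slot b n' t else n'
  end.

Lemma slot_bounds b n t : (t < psum b n)%nat ->
  (slot b n t < n)%nat /\ (psum b (slot b n t) <= t < psum b (S (slot b n t)))%nat.
Proof.
  induction n as [|n IH]; simpl; [lia|]. intros H.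
  destruct (Nat.ltb_spec t (psum b n)) as [Hlt|Hge].
  - specialize (IH Hlt). simpl in IH. lia.
  - simpl. lia.
Qed.

Lemma psum_mono b n n' : (n <= n')%nat -> (psum b n <= psum b n')%nat.
Proof. induction 1; simpl; lia. Qed.

Lemma count_interval (lo len n : nat) :
  (count (fun t => (lo <=? t) && (t <? lo + len))%nat%bool (seq 0 n) <= len)%nat.
Proof.
  enough (count (fun t => (lo <=? t) && (t <? lo + len))%nat%bool (seq 0 n)
          = Nat.min len (n - lo)) by lia.
  induction n as [|n IH]; [cbn; lia|].
  rewrite seq_S, count_app, IH, count_cons, count_nil. cbn [Nat.add].
  destruct (Nat.leb_spec lo n), (Nat.ltb_spec n (lo + len)); cbn [andb]; lia.
Qed.

(** All [t] with slot [i] lie in the interval of length [b i] that starts at [psum b i]. *)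
Lemma count_slot_le b n L i : (L <= psum b n)%nat ->
  (count (fun t => Nat.eqb (slot b n t) i) (seq 0 L) <= b i)%nat.
Proof.
  intros HL. etransitivity; [|apply (count_interval (psum b i) (b i) L)].
  apply count_le. intros t Ht E. apply in_seq in Ht. apply Nat.eqb_eq in E.
  destruct (slot_bounds b n t) as [_ H]; [lia|]. rewrite E in H. simpl in H.
  apply andb_true_intro. split; [apply Nat.leb_le|apply Nat.ltb_lt]; lia.
Qed.

(** Double counting: each [x] contributes at least 1 to the sum over [i]. *)
Lemma psum_count_ge {B} (fits : nat -> B -> bool) N (X : list B) :
  (forall x, In x X -> exists i, (i < N)%nat /\ fits i x = true) ->
  (length X <= psum (fun i => count (fits i) X) N)%nat.
Proof.
  induction X as [|x X IH]; intros H; [simpl; lia|].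
  assert (E : forall n, psum (fun i => count (fits i) (x :: X)) n =
    (psum (fun i => if fits i x then 1%nat else 0%nat) n + psum (fun i => count (fits i) X) n)%nat).
  { induction n as [|n IHn]; [easy|]. cbn [psum]. rewrite IHn, count_cons. lia. }
  rewrite E.
  assert (length X <= psum (fun i => count (fits i) X) N)%nat
    by (apply IH; intros; apply H; simpl; auto).
  destruct (H x (or_introl eq_refl)) as [i [Hi Hf]].
  pose proof (psum_mono (fun i => if fits i x then 1%nat else 0%nat) (S i) N Hi) as Hm.
  simpl in Hm. rewrite Hf in Hm. simpl. lia.
Qed.

Lemma psum_sub_add a c N : (forall i, (i < N)%nat -> (a i <= c i)%nat) ->
  (psum (fun i => c i - a i) N + psum a N = psum c N)%nat.
Proof.
  induction N as [|N IH]; intros H; simpl; [easy|].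
  specialize (IH (fun i Hi => H i (Nat.lt_lt_succ_r _ _ Hi))).
  specialize (H N (Nat.lt_succ_diag_r N)). lia.
Qed.

Lemma psum_count_key {A} (key : A -> nat) N (L : list A) :
  (psum (fun i => count (fun a => Nat.eqb (key a) i) L) N <= length L)%nat.
Proof.
  induction L as [|a L IH].
  - simpl. enough (psum (fun i => count (fun a => Nat.eqb (key a) i) []) N = 0)%nat by lia.
    induction N; simpl; [easy|]. unfold count in *. simpl in *. lia.
  - assert (E : forall n, psum (fun i => count (fun a => Nat.eqb (key a) i) (a :: L)) n =
      ((if (key a <? n)%nat then 1 else 0) + psum (fun i => count (fun a => Nat.eqb (key a) i) L) n)%nat).
    { induction n as [|n IHn]; [easy|]. cbn [psum]. rewrite IHn, count_cons.
      destruct (Nat.ltb_spec (key a) n), (Nat.ltb_spec (key a) (S n)), (Nat.eqb_spec (key a) n); lia. }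
    rewrite E. simpl. destruct (key a <? N)%nat; lia.
Qed.

(** The multiples [t * N] below [y] are those with [t] below the ceiling of [y / N]. *)
Lemma count_lt_mul N y P : (0 < N)%nat ->
  count (fun t => (t * N <? y)%nat) (seq 0 P) = Nat.min P ((y + N - 1) / N).
Proof.
  intros HN. induction P as [|P IH]; [easy|].
  rewrite seq_S, count_app, IH, count_cons, count_nil. cbn [Nat.add].
  pose proof (Nat.div_mod_eq (y + N - 1) N) as E.
  pose proof (Nat.mod_upper_bound (y + N - 1) N ltac:(lia)) as Hm.
  set (q := ((y + N - 1) / N)%nat) in *.
  destruct (Nat.ltb_spec (P * N) y) as [H|H]; [assert (P < q)%nat by nia|assert (q <= P)%nat by nia]; lia.
Qed.

(** Equidistribution of the targets in one layer. The quotient equals [i] exactly when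
    [i * P <= t * N < S i * P], so the count is a difference of two ceilings and differs from
    [P / N] by at most 1. The bounds are multiplied by [N] to stay in the natural numbers. *)
Lemma count_scaled N P i : (0 < N)%nat -> (0 < P)%nat -> (i < N)%nat ->
  (N * count (fun t => Nat.eqb (t * N / P) i) (seq 0 P) <= P + N /\
   P <= N * count (fun t => Nat.eqb (t * N / P) i) (seq 0 P) + N)%nat.
Proof.
  intros HN HP Hi.
  assert (E : (count (fun t => Nat.eqb (t * N / P) i) (seq 0 P)
     + count (fun t => (t * N <? i * P)%nat) (seq 0 P)
     = count (fun t => (t * N <? S i * P)%nat) (seq 0 P))%nat).
  { induction (seq 0 P) as [|t l IH]; [easy|]. rewrite !count_cons, <- IH.
    pose proof (Nat.div_mod_eq (t * N) P) as E.
    pose proof (Nat.mod_upper_bound (t * N) P ltac:(lia)) as Hm.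
    set (q := (t * N / P)%nat) in *.
    destruct (Nat.eqb_spec q i) as [Hq|Hq], (Nat.ltb_spec (t * N) (i * P)),
      (Nat.ltb_spec (t * N) (S i * P)); try lia; exfalso; nia. }
  rewrite !count_lt_mul in E by easy.
  set (c := count _ _) in *. clearbody c.
  assert (D : forall y, exists q, ((y + N - 1) / N = q /\ y <= N * q <= y + N - 1)%nat).
  { intros y. eexists. split; [reflexivity|].
    pose proof (Nat.div_mod_eq (y + N - 1) N).
    pose proof (Nat.mod_upper_bound (y + N - 1) N ltac:(lia)). lia. }
  destruct (D (i * P)%nat) as [q1 [E1 H1]], (D (S i * P)%nat) as [q2 [E2 H2]].
  rewrite E1, E2 in E.
  assert (q1 <= P)%nat by nia. assert (q2 <= P)%nat by nia.
  rewrite !Nat.min_r in E by easy. nia.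
Qed.

(** * A snake-like enumeration of the grid *)

(** The reflected base-[m] Gray code: the slab with leading coordinate [q] is traversed forwards if
    [q] is even and backwards if [q] is odd. [unsnake] is the inverse. *)
Fixpoint snake (m d i : nat) : list nat :=
  match d with
  | O => []
  | S d' =>
      let q := (i / m ^ d')%nat in
      let r := (i mod m ^ d')%nat in
      q :: snake m d' (if Nat.even q then r else m ^ d' - 1 - r)%nat
  end.

Fixpoint unsnake (m : nat) (l : list nat) : nat :=
  match l with
  | [] => O
  | q :: l' =>
      let r := unsnake m l' in
      (q * m ^ length l' + (if Nat.even q then r else m ^ length l' - 1 - r))%nat
  end.

Lemma natpow_pos m d : (0 < m)%nat -> (0 < m ^ d)%nat.
Proof. intros. apply Nat.neq_0_lt_0, Nat.pow_nonzero. lia. Qed.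

Lemma snake_length m d i : length (snake m d i) = d.
Proof. revert i; induction d; simpl; intros; [easy|]. now rewrite IHd. Qed.

Lemma snake_bound m d i : (0 < m)%nat -> (i < m ^ d)%nat -> Forall (fun q => (q < m)%nat) (snake m d i).
Proof.
  intros Hm. revert i. induction d as [|d IH]; intros i Hi; [constructor|].
  cbn [snake]. pose proof (natpow_pos m d Hm).
  pose proof (Nat.mod_upper_bound i (m ^ d) ltac:(lia)).
  constructor.
  - apply Nat.Div0.div_lt_upper_bound. simpl in Hi. lia.
  - apply IH. destruct (Nat.even _); lia.
Qed.

Lemma unsnake_bound m l : (0 < m)%nat -> Forall (fun q => (q < m)%nat) l ->
  (unsnake m l < m ^ length l)%nat.
Proof.
  intros Hm. induction 1 as [|q l Hq Hl IH]; [simpl; lia|].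
  cbn [unsnake length]. rewrite Nat.pow_succ_r'.
  destruct (Nat.even q); nia.
Qed.

Lemma snake_unsnake m l : (0 < m)%nat -> Forall (fun q => (q < m)%nat) l ->
  snake m (length l) (unsnake m l) = l.
Proof.
  intros Hm. induction 1 as [|q l Hq Hl IH]; [easy|].
  cbn [unsnake length snake].
  pose proof (unsnake_bound m l Hm Hl) as Hb. pose proof (natpow_pos m (length l) Hm) as Hp.
  set (w := (if Nat.even q then unsnake m l else m ^ length l - 1 - unsnake m l)%nat).
  assert (Hw : (w < m ^ length l)%nat) by (unfold w; destruct (Nat.even q); lia).
  rewrite Nat.div_add_l, (Nat.div_small w), Nat.add_0_r by lia.
  rewrite (Nat.add_comm (q * _)), Nat.Div0.mod_add, Nat.mod_small by lia.
  f_equal. etransitivity; [|exact IH]. f_equal. unfold w. destruct (Nat.even q); lia.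
Qed.

Lemma unsnake_snake m d i : (0 < m)%nat -> (i < m ^ d)%nat -> unsnake m (snake m d i) = i.
Proof.
  intros Hm. revert i. induction d as [|d IH]; intros i Hi; [simpl in *; lia|].
  cbn [snake unsnake]. rewrite snake_length. pose proof (natpow_pos m d Hm).
  pose proof (Nat.mod_upper_bound i (m ^ d) ltac:(lia)).
  rewrite IH by (destruct (Nat.even _); lia).
  pose proof (Nat.div_mod_eq i (m ^ d)).
  destruct (Nat.even _); lia.
Qed.

Definition near (n : nat) (l l' : list nat) : Prop :=
  Forall2 (fun a b => (a <= b + n /\ b <= a + n)%nat) l l'.

Lemma near_refl n l : near n l l.
Proof. induction l; constructor; [lia|easy]. Qed.

Lemma near_sym n l l' : near n l l' -> near n l' l.
Proof. induction 1; constructor; [lia|easy]. Qed.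

Lemma near_trans n n' l l' l'' : near n l l' -> near n' l' l'' -> near (n + n') l l''.
Proof.
  intros H; revert l''. induction H as [|a b l l' H Hl IH]; intros l'' H'; inversion H'; subst; constructor.
  - lia.
  - now apply IH.
Qed.

(** Either the path stays in its slab and induction applies, or it enters the next slab, where the
    reversed direction makes the remaining coordinates start where they just ended. *)
Lemma near_snake_succ m d i : (0 < m)%nat -> (S i < m ^ d)%nat ->
  near 1 (snake m d i) (snake m d (S i)).
Proof.
  intros Hm. revert i. induction d as [|d IH]; intros i Hi; [constructor|].
  pose proof (natpow_pos m d Hm) as Hp.
  cbn [snake].
  pose proof (Nat.div_mod_eq i (m ^ d)) as E. pose proof (Nat.mod_upper_bound i (m ^ d) ltac:(lia)) as Hr.
  set (p := (m ^ d)%nat) in *. set (q := (i / p)%nat) in *. set (r := (i mod p)%nat) in *.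
  destruct (Nat.eq_dec (S r) p) as [Hlast|Hlast].
  - assert (Eq : (S i / p = S q)%nat) by (symmetry; apply (Nat.div_unique _ _ _ 0); nia).
    assert (Er : (S i mod p = 0)%nat) by (symmetry; apply (Nat.mod_unique _ _ (S q)); nia).
    rewrite Eq, Er. constructor; [lia|].
    rewrite Nat.even_succ, <- Nat.negb_even.
    replace r with (p - 1)%nat by lia.
    destruct (Nat.even q); simpl negb; cbv iota;
      [replace (p - 1 - 0)%nat with (p - 1)%nat by lia|replace (p - 1 - (p - 1))%nat with 0%nat by lia];
      apply near_refl.
  - assert (Eq : (S i / p = q)%nat) by (symmetry; apply (Nat.div_unique _ _ _ (S r)); nia).
    assert (Er : (S i mod p = S r)%nat) by (symmetry; apply (Nat.mod_unique _ _ q); nia).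
    rewrite Eq, Er. constructor; [lia|].
    destruct (Nat.even q); [apply IH; lia|].
    (* In an odd slab the step is a backward one of the inner path. *)
    apply near_sym. replace (p - 1 - r)%nat with (S (p - 1 - S r)) by lia. apply IH. lia.
Qed.

Lemma near_snake m d n i j : (0 < m)%nat -> (i < m ^ d)%nat -> (j < m ^ d)%nat ->
  (i <= j + n)%nat -> (j <= i + n)%nat -> near n (snake m d i) (snake m d j).
Proof.
  intros Hm.
  assert (Up : forall k i, (i + k < m ^ d)%nat -> near k (snake m d i) (snake m d (i + k))).
  { induction k as [|k IHk]; intros i' Hk; [rewrite Nat.add_0_r; apply near_refl|].
    replace (S k) with (k + 1)%nat at 1 by lia. rewrite (Nat.add_succ_r i' k).
    apply near_trans with (snake m d (i' + k)); [apply IHk; lia|]. apply near_snake_succ; lia. }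
  assert (Weak : forall k l l', (k <= n)%nat -> near k l l' -> near n l l').
  { intros k l l' Hk. induction 1; constructor; [lia|easy]. }
  intros Hi Hj H1 H2. destruct (Nat.le_ge_cases i j).
  - apply (Weak (j - i)%nat); [lia|]. replace j with (i + (j - i))%nat at 2 by lia. apply Up. lia.
  - apply (Weak (i - j)%nat); [lia|]. apply near_sym.
    replace i with (j + (i - j))%nat at 2 by lia. apply Up. lia.
Qed.

(** * Ranks in the balanced tree *)

Fixpoint width (s : nat -> nat) (j : nat) : nat :=
  match j with O => 1%nat | S j' => (width s j' * s (S j'))%nat end.

(* Mixed-radix value of [v]: the position of [v] in [level s (length v)]. *)
Fixpoint rank_from (s : nat -> nat) (j acc : nat) (v : list nat) : nat :=
  match v with
  | [] => acc
  | a :: v' => rank_from s (S j) (acc * s (S j) + a) v'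
  end.

Definition rank (s : nat -> nat) (v : list nat) : nat := rank_from s 0 0 v.

(** [rank_from] consumes the path from the root, so the induction needs an arbitrary starting depth
    and accumulator. *)
Lemma rank_child s u a : rank s (u ++ [a]) = (rank s u * s (S (length u)) + a)%nat.
Proof.
  unfold rank. change (length u) with (0 + length u)%nat.
  generalize 0%nat at 1 3 5 as j. generalize 0%nat as acc.
  induction u as [|b u IH]; intros acc j; simpl.
  - now rewrite Nat.add_0_r.
  - rewrite IH. now rewrite Nat.add_succ_r.
Qed.

Lemma level_length s j v : In v (level s j) -> length v = j.
Proof.
  revert v. induction j as [|j IH]; simpl; intros v H.
  - destruct H as [<-|[]]. easy.
  - apply in_flat_map in H as [u [Hu H]]. apply in_map_iff in H as [a [<- _]].
    rewrite length_app, (IH u Hu). simpl. lia.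
Qed.

Lemma level_child s j u a : In (u ++ [a]) (level s (S j)) -> (a < s (S j))%nat.
Proof.
  simpl. intros H. apply in_flat_map in H as [v [_ H]]. apply in_map_iff in H as [b [E Hb]].
  apply app_inj_tail in E as [_ <-]. apply in_seq in Hb. lia.
Qed.

Lemma seq_scale k n : flat_map (fun t => seq (t * k) k) (seq 0 n) = seq 0 (n * k).
Proof.
  induction n as [|n IH]; [easy|].
  rewrite seq_S, flat_map_app, IH. simpl. rewrite app_nil_r.
  rewrite Nat.add_comm, seq_app. easy.
Qed.

(** The children of the vertex of rank [t] occupy the block of ranks from [t * s (S j)] on, and
    [seq_scale] glues these blocks. Counting vertices of a layer thereby becomes counting
    numbers. *)
Lemma map_rank_level s j : map (rank s) (level s j) = seq 0 (width s j).
Proof.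
  induction j as [|j IH]; [easy|].
  cbn [level width]. rewrite <- seq_scale, <- IH.
  pose proof (level_length s j) as Hlen. clear IH.
  induction (level s j) as [|v l IHl]; [easy|].
  simpl. rewrite map_app, IHl by (intros; apply Hlen; simpl; auto). f_equal.
  rewrite map_map.
  transitivity (map (fun a => rank s v * s (S j) + a)%nat (seq 0 (s (S j)))).
  - apply map_ext. intros a. rewrite rank_child, (Hlen v) by (simpl; auto). easy.
  - enough (H : forall b k o, map (fun a => b + a)%nat (seq o k) = seq (b + o) k)
      by now rewrite H, Nat.add_0_r.
    intros b k. induction k as [|k IHk]; intros o; simpl; [easy|].
    now rewrite IHk, Nat.add_succ_r.
Qed.

Lemma rank_bound s j v : In v (level s j) -> (rank s v < width s j)%nat.
Proof.
  intros H. apply (in_map (rank s)) in H. rewrite map_rank_level in H. apply in_seq in H. lia.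
Qed.

Lemma count_level s j (f : nat -> nat -> bool) :
  count (fun v => f (length v) (rank s v)) (level s j) = count (f j) (seq 0 (width s j)).
Proof.
  rewrite <- map_rank_level, count_map. apply count_ext.
  intros v Hv. now rewrite (level_length s j v Hv).
Qed.

(** For [n = h] these are the vertices of the tree that are not leaves. *)
Definition upper (s : nat -> nat) (n : nat) : list (list nat) := flat_map (level s) (seq 0 n).

Lemma upper_S s n : upper s (S n) = upper s n ++ level s n.
Proof. unfold upper. rewrite seq_S, flat_map_app. simpl. now rewrite app_nil_r. Qed.

Lemma in_upper s n v : In v (upper s n) <-> (length v < n)%nat /\ In v (level s (length v)).
Proof.
  unfold upper. rewrite in_flat_map. split.
  - intros [j [Hj Hv]]. apply in_seq in Hj. rewrite (level_length _ _ _ Hv). split; [lia|easy].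
  - intros [Hl Hv]. exists (length v). split; [apply in_seq; lia|easy].
Qed.

Lemma length_level s j : length (level s j) = width s j.
Proof. rewrite <- (length_map (rank s)), map_rank_level. apply length_seq. Qed.

Lemma length_upper s n : length (upper s n) = psum (width s) n.
Proof.
  induction n as [|n IH]; [easy|]. rewrite upper_S, length_app, IH, length_level. easy.
Qed.

(** * Geometry of cells *)

Lemma Rabs_le_inv x a : Rabs x <= a -> - a <= x <= a.
Proof. intros H. split_Rabs; lra. Qed.

Lemma sqdist_le x y beta : Forall2 (fun a b => Rabs (a - b) <= beta) x y ->
  sqdist x y <= INR (length x) * beta ^ 2.
Proof.
  induction 1 as [|a b x y Hab _ IH]; [simpl; lra|].
  cbn [sqdist length]. rewrite S_INR.
  assert ((a - b) ^ 2 <= beta ^ 2) by (apply pow_maj_Rabs; easy). lra.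
Qed.

Lemma dist_le x y beta : 0 <= beta -> Forall2 (fun a b => Rabs (a - b) <= beta) x y ->
  Defs.dist x y <= sqrt (INR (length x)) * beta.
Proof.
  intros Hb H. unfold Defs.dist. rewrite <- (sqrt_pow2 beta Hb) at 1.
  rewrite <- sqrt_mult; [|apply pos_INR|apply pow2_ge_0].
  apply sqrt_le_1_alt. now apply sqdist_le.
Qed.

Lemma in_closed_cube_bP sd l x : in_closed_cube_b sd l x = true <->
  Forall2 (fun q a => INR q * sd <= a <= (INR q + 1) * sd) l x.
Proof.
  revert x. induction l as [|q l IH]; intros [|a x]; simpl.
  - split; auto.
  - split; [easy|]. inversion 1.
  - split; [easy|]. inversion 1.
  - rewrite !Bool.andb_true_iff, IH. unfold Rle_b.
    destruct (Rle_dec (INR q * sd) a), (Rle_dec a ((INR q + 1) * sd));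
      (split; [intros [[? ?] ?]|inversion 1; subst]); try easy; try tauto; constructor; tauto.
Qed.

(** In each coordinate the lower corners differ by at most [B] sides, and the positions inside the
    two cells add at most one more side. *)
Lemma dist_cubes m l l' x y B : (0 < m)%nat -> 0 <= B ->
  in_closed_cube_b (/ INR m) l x = true -> in_closed_cube_b (/ INR m) l' y = true ->
  Forall2 (fun q q' => Rabs (INR q - INR q') <= B) l l' ->
  Defs.dist x y <= sqrt (INR (length l)) * ((B + 1) / INR m).
Proof.
  intros Hm HB Hx Hy Hl. apply lt_0_INR in Hm as Hm'.
  assert (Hi : 0 < / INR m) by now apply Rinv_0_lt_compat.
  apply in_closed_cube_bP in Hx. apply in_closed_cube_bP in Hy.
  assert (E : length l = length x) by now apply Forall2_length in Hx.
  rewrite E. apply dist_le.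
  - apply Rmult_le_pos; lra.
  - clear E. revert x y Hx Hy. induction Hl as [|q q' l l' Hq _ IH]; intros x y Hx Hy;
      inversion Hx; inversion Hy; subst; constructor.
    + apply Rabs_le. unfold Rdiv. apply Rabs_le_inv in Hq as Hq'. nra.
    + now apply IH.
Qed.

(* Coordinates are measured in units of the side [/ INR m], so that [q + 1/2] is
   the centre of the cell [q] and [m / 2] the centre of the unit interval. *)
Definition coord (m : nat) (lam : R) (q : nat) : R :=
  INR m / 2 + lam * (INR q + / 2 - INR m / 2).

Definition cell (m : nat) (lam : R) (q : nat) : nat := Z.to_nat (Int_part (coord m lam q)).

Lemma nat_floor x : 0 <= x -> INR (Z.to_nat (Int_part x)) <= x < INR (Z.to_nat (Int_part x)) + 1.
Proof.
  intros Hx. destruct (base_Int_part x) as [H1 H2].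
  assert (0 <= Int_part x)%Z.
  { apply Z.lt_succ_r. apply lt_IZR. rewrite succ_IZR. lra. }
  rewrite INR_IZR_INZ, Z2Nat.id by easy. lra.
Qed.

(** Contracting towards the centre keeps the coordinate between [1/2] and [m - 1/2], so its floor is
    a valid cell index. *)
Lemma cell_spec m lam q : 0 <= lam <= 1 -> (q < m)%nat ->
  INR (cell m lam q) <= coord m lam q < INR (cell m lam q) + 1 /\ (cell m lam q < m)%nat.
Proof.
  intros Hl Hq. apply le_INR in Hq. rewrite S_INR in Hq. pose proof (pos_INR q).
  assert (H0 : / 2 <= coord m lam q <= INR m - / 2) by (unfold coord; split; nra).
  pose proof (nat_floor (coord m lam q) ltac:(lra)) as Hf. fold (cell m lam q) in Hf.
  split; [easy|]. apply INR_lt. lra.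
Qed.

Lemma cell_1 m q : (q < m)%nat -> cell m 1 q = q.
Proof.
  intros Hq. destruct (cell_spec m 1 q ltac:(lra) Hq) as [H _].
  assert (E : coord m 1 q = INR q + / 2) by (unfold coord; lra). rewrite E in H.
  set (c := cell m 1 q) in *. clearbody c.
  assert (c < S q)%nat by (apply INR_lt; rewrite S_INR; lra).
  assert (q < S c)%nat by (apply INR_lt; rewrite S_INR; lra). lia.
Qed.

(** The change of coordinate splits into a change of parameter, acting on an offset of at most
    [m / 2] from the centre, and [lam] times the jump of the target. The second part is at most 1,
    and vanishes for [lam = 0] however far the target jumps. The two floors cost the other 1 of the
    constant 2. *)
Lemma cell_step m lam lam' q q' : 0 <= lam <= 1 -> 0 <= lam' <= 1 -> (q < m)%nat -> (q' < m)%nat ->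
  lam = 0 \/ (q <= q' + 1 /\ q' <= q + 1)%nat ->
  Rabs (INR (cell m lam q) - INR (cell m lam' q')) <= Rabs (lam - lam') * INR m / 2 + 2.
Proof.
  intros Hl Hl' Hq Hq' Hd.
  destruct (cell_spec m lam q Hl Hq) as [H _]. destruct (cell_spec m lam' q' Hl' Hq') as [H' _].
  assert (E : coord m lam q - coord m lam' q' =
     (lam - lam') * (INR q' + / 2 - INR m / 2) + lam * (INR q - INR q')) by (unfold coord; ring).
  assert (E1 : Rabs (lam * (INR q - INR q')) <= 1).
  { destruct Hd as [->|[H1 H2]]; [rewrite Rmult_0_l, Rabs_R0; lra|].
    apply le_INR in H1, H2. rewrite plus_INR in H1, H2. simpl in H1, H2.
    apply Rabs_le. nra. }
  assert (E2 : Rabs ((lam - lam') * (INR q' + / 2 - INR m / 2)) <= Rabs (lam - lam') * INR m / 2).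
  { rewrite Rabs_mult. unfold Rdiv at 2. rewrite Rmult_assoc.
    apply Rmult_le_compat_l; [apply Rabs_pos|].
    apply le_INR in Hq'. rewrite S_INR in Hq'. pose proof (pos_INR q').
    apply Rabs_le. lra. }
  apply Rabs_le_inv in E1, E2. apply Rabs_le. lra.
Qed.

(** * The embedding for a fixed height *)

(** The cube for a non-leaf of depth [j] and rank [t]: its target, contracted by [lam j]. Applying
    [unsnake] encodes the cube as a number below [m ^ d], the form of key used in the matching. *)
Definition inner_key (m d : nat) (s : nat -> nat) (lam : nat -> R) (j t : nat) : nat :=
  unsnake m (map (cell m (lam j)) (snake m d (t * m ^ d / width s j))).

Lemma scaled_bound N P t : (t < P)%nat -> (0 < N)%nat -> (t * N / P < N)%nat.
Proof. intros. apply Nat.Div0.div_lt_upper_bound. nia. Qed.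

Lemma inner_cube m d s lam j t : (0 < m)%nat -> 0 <= lam j <= 1 -> (t < width s j)%nat ->
  (inner_key m d s lam j t < m ^ d)%nat /\
  snake m d (inner_key m d s lam j t) = map (cell m (lam j)) (snake m d (t * m ^ d / width s j)).
Proof.
  intros Hm Hl Ht. unfold inner_key.
  pose proof (scaled_bound (m ^ d) _ _ Ht (natpow_pos m d Hm)) as Hi.
  pose proof (snake_bound m d _ Hm Hi) as Hb.
  pose proof (snake_length m d (t * m ^ d / width s j)) as Hlen.
  set (l := snake _ _ _) in *. clearbody l.
  assert (Hb' : Forall (fun q => (q < m)%nat) (map (cell m (lam j)) l)).
  { apply Forall_map. eapply Forall_impl; [|exact Hb]. intros q Hq. now apply cell_spec. }
  split.
  - pose proof (unsnake_bound m _ Hm Hb') as H. now rewrite length_map, Hlen in H.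
  - pose proof (snake_unsnake m _ Hm Hb') as H. now rewrite length_map, Hlen in H.
Qed.

Lemma inner_key_1 m d s lam j t : (0 < m)%nat -> lam j = 1 -> (t < width s j)%nat ->
  inner_key m d s lam j t = (t * m ^ d / width s j)%nat.
Proof.
  intros Hm Hl Ht. unfold inner_key. rewrite Hl.
  pose proof (scaled_bound (m ^ d) _ _ Ht (natpow_pos m d Hm)) as Hi.
  rewrite <- (unsnake_snake m d _ Hm Hi) at 2. f_equal.
  rewrite <- map_id. apply map_ext_in. intros q Hq.
  apply cell_1. pose proof (snake_bound m d _ Hm Hi) as Hb. rewrite Forall_forall in Hb. now apply Hb.
Qed.

(** From depth [j1] on, vertices sit in their targets and each layer deviates by at most one vertex
    per cube, at most [n] in total. The layers above [j1] may be distributed arbitrarily, which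
    costs at most their size. *)
Lemma count_inner m d s lam h j1 i n : (0 < m)%nat -> (i < m ^ d)%nat ->
  (forall j, (j <= h)%nat -> (0 < width s j)%nat) ->
  (forall j, (j1 <= j)%nat -> lam j = 1) -> (n <= h)%nat ->
  let N := (m ^ d)%nat in
  let a := count (fun v => Nat.eqb (inner_key m d s lam (length v) (rank s v)) i) (upper s n) in
  (N * a <= psum (width s) n + N * (n + psum (width s) j1) /\
   psum (width s) n <= N * a + N * (n + psum (width s) j1))%nat.
Proof.
  intros Hm Hi Hw Hl Hn N.
  (* With [Nat.min n j1] the error term grows only while [n < j1], so the bound passes through
     induction on [n]. *)
  enough (H : (let a := count (fun v => Nat.eqb (inner_key m d s lam (length v) (rank s v)) i) (upper s n) in
    N * a <= psum (width s) n + N * (n + psum (width s) (Nat.min n j1)) /\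
    psum (width s) n <= N * a + N * (n + psum (width s) (Nat.min n j1)))%nat).
  { pose proof (psum_mono (width s) (Nat.min n j1) j1 ltac:(lia)). cbv zeta in *. nia. }
  assert (HN : (0 < N)%nat) by now apply natpow_pos.
  induction n as [|n IH]; cbv zeta in *; [unfold upper, count; simpl; lia|].
  rewrite upper_S, count_app, (count_level s n (fun j t => Nat.eqb (inner_key m d s lam j t) i)).
  specialize (IH ltac:(lia)). cbn [psum].
  destruct (Nat.le_gt_cases j1 n) as [Hj|Hj].
  - rewrite (count_ext _ (fun t => Nat.eqb (t * N / width s n) i)).
    2:{ intros t Ht. apply in_seq in Ht. rewrite inner_key_1; [easy|easy|now apply Hl|lia]. }
    pose proof (count_scaled N (width s n) i HN (Hw n ltac:(lia)) Hi) as Hc.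
    rewrite Nat.min_r in * by lia. nia.
  - set (c := count _ (seq _ _)).
    assert (Hc : (c <= width s n)%nat) by (etransitivity; [apply count_le_length|now rewrite length_seq]).
    rewrite Nat.min_l in * by lia. cbn [psum]. nia.
Qed.

(** With [z = t * k + a] and [W = P * k], the target [i] of the parent satisfies
    [i * W <= N * z < (i + 2) * W], while the hypotheses place [N * z / W] in the cell [i'] up to an
    error of a quarter. *)
Lemma leaf_key_near (N P k t a i' : nat) :
  (a < k)%nat -> (N <= P)%nat -> (0 < N)%nat ->
  INR i' * INR (P * k) <= INR N * INR (t * k + a) + INR (P * k) / 4 ->
  INR N * INR (t * k + a) < (INR i' + 1) * INR (P * k) + INR (P * k) / 4 ->
  (t * N / P <= i' + 2 /\ i' <= t * N / P + 2)%nat.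
Proof.
  intros Ha HNP HN H1 H2.
  pose proof (Nat.div_mod_eq (t * N) P) as E.
  pose proof (Nat.mod_upper_bound (t * N) P ltac:(lia)) as Hm.
  set (i := (t * N / P)%nat) in *. set (r := (t * N mod P)%nat) in *. clearbody i r.
  assert (L : (i * (P * k) <= N * (t * k + a))%nat) by nia.
  assert (U : (N * (t * k + a) < (i + 2) * (P * k))%nat).
  { assert (N * t * k < (i + 1) * P * k)%nat by (apply Nat.mul_lt_mono_pos_r; nia).
    assert (N * a <= P * k)%nat by (apply Nat.mul_le_mono; lia). nia. }
  set (W := (P * k)%nat) in *. assert (HW : (0 < W)%nat) by (unfold W; nia).
  set (z := (t * k + a)%nat) in *. clearbody W z.
  apply lt_0_INR in HW. apply le_INR in L. apply lt_INR in U.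
  rewrite !mult_INR in L, U. rewrite plus_INR in U. simpl in U.
  assert (A1 : INR i' < INR i + 3) by (apply Rmult_lt_reg_r with (INR W); lra).
  assert (A2 : INR i < INR i' + 2) by (apply Rmult_lt_reg_r with (INR W); lra).
  split.
  - assert (i < i' + 2)%nat by (apply INR_lt; rewrite plus_INR; simpl; lra). lia.
  - assert (i' < i + 3)%nat by (apply INR_lt; rewrite plus_INR; simpl; lra). lia.
Qed.

(** Passing to child [a] adds [a * N / (P * k)] to the exact position, which is below 1 because
    [N <= P]. *)
Lemma scaled_step N P k t a : (a < k)%nat -> (N <= P)%nat -> (0 < N)%nat ->
  (t * N / P <= (t * k + a) * N / (P * k) + 1 /\ (t * k + a) * N / (P * k) <= t * N / P + 1)%nat.
Proof.
  intros Ha HNP HN.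
  pose proof (Nat.div_mod_eq (t * N) P) as E.
  pose proof (Nat.mod_upper_bound (t * N) P ltac:(lia)) as Hm.
  set (i := (t * N / P)%nat) in *. set (r := (t * N mod P)%nat) in *. clearbody i r.
  assert (L : (i * (P * k) <= (t * k + a) * N)%nat) by nia.
  assert (U : ((t * k + a) * N < (i + 2) * (P * k))%nat).
  { assert (N * t * k < (i + 1) * P * k)%nat by (apply Nat.mul_lt_mono_pos_r; nia).
    assert (N * a <= P * k)%nat by (apply Nat.mul_le_mono; lia). nia. }
  assert (W : (P * k <> 0)%nat) by nia.
  pose proof (Nat.div_mod_eq ((t * k + a) * N) (P * k)) as E'.
  pose proof (Nat.mod_upper_bound ((t * k + a) * N) (P * k) W) as Hm'.
  set (W' := (P * k)%nat) in *. set (z := ((t * k + a) * N)%nat) in *. nia.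
Qed.

Lemma psum_near (b : nat -> nat) (N : nat) (W D : R) n : (n <= N)%nat -> 0 <= D ->
  (forall i, (i < N)%nat -> Rabs (INR N * INR (b i) - W) <= D) ->
  Rabs (INR N * INR (psum b n) - INR n * W) <= INR N * D.
Proof.
  intros Hn HD Hb.
  enough (Rabs (INR N * INR (psum b n) - INR n * W) <= INR n * D).
  { apply le_INR in Hn. nra. }
  induction n as [|n IH]; [simpl; rewrite Rabs_pos_eq; lra|].
  cbn [psum]. rewrite plus_INR, S_INR.
  specialize (IH ltac:(lia)). specialize (Hb n Hn).
  apply Rabs_le_inv in IH, Hb. apply Rabs_le. lra.
Qed.

Lemma btree_upper s h : btree_vertices s h = upper s h ++ level s h.
Proof. rewrite <- upper_S. easy. Qed.

Lemma in_btree s h v : In v (btree_vertices s h) <-> (length v <= h)%nat /\ In v (level s (length v)).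
Proof. change (btree_vertices s h) with (upper s (S h)). rewrite in_upper. split; intros []; split; auto; lia. Qed.

Lemma btree_size_psum s h : btree_size s h = (psum (width s) h + width s h)%nat.
Proof. unfold btree_size. rewrite btree_upper, length_app, length_upper, length_level. easy. Qed.

Lemma width_pos s h : (forall i, (1 <= i <= h)%nat -> (2 <= s i)%nat) ->
  forall j, (j <= h)%nat -> (0 < width s j)%nat.
Proof.
  intros Hs j. induction j as [|j IH]; intros Hj; simpl; [lia|].
  specialize (Hs (S j) ltac:(lia)). specialize (IH ltac:(lia)). nia.
Qed.

(** The block boundaries satisfy [N * psum b i = i * W] up to [N * D], hence up to [W / 4]. So the
    slot of [t] is the floor of [N * t / W] up to a quarter. *)
Lemma slot_scaled (b : nat -> nat) (N W t : nat) (D : R) :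
  0 <= D -> (0 < N)%nat ->
  (forall i, (i < N)%nat -> Rabs (INR N * INR (b i) - INR W) <= D) ->
  4 * (INR N * D) <= INR W -> (t < psum b N)%nat ->
  (slot b N t < N)%nat /\
  INR (slot b N t) * INR W <= INR N * INR t + INR W / 4 /\
  INR N * INR t < (INR (slot b N t) + 1) * INR W + INR W / 4.
Proof.
  intros HD HN Hb HW Ht. destruct (slot_bounds b N t Ht) as [Hi [H1 H2]].
  set (i := slot b N t) in *. clearbody i.
  pose proof (psum_near b N (INR W) D i ltac:(lia) HD Hb) as N1.
  pose proof (psum_near b N (INR W) D (S i) ltac:(lia) HD Hb) as N2.
  apply Rabs_le_inv in N1, N2. rewrite S_INR in N2.
  apply le_INR in H1. apply lt_INR in H2. apply lt_0_INR in HN.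
  split; [easy|]. split; nra.
Qed.

Lemma near_Rabs n l l' : near n l l' -> Forall2 (fun q q' => Rabs (INR q - INR q') <= INR n) l l'.
Proof.
  induction 1 as [|q q' l l' [H1 H2] _ IH]; constructor; [|easy].
  apply le_INR in H1, H2. rewrite plus_INR in H1, H2. apply Rabs_le. lra.
Qed.

Lemma cells_step m lam lam' step l l' : 0 <= lam <= 1 -> 0 <= lam' <= 1 ->
  Rabs (lam - lam') <= step ->
  Forall (fun q => (q < m)%nat) l -> Forall (fun q => (q < m)%nat) l' -> length l = length l' ->
  lam = 0 \/ near 1 l l' ->
  Forall2 (fun q q' => Rabs (INR q - INR q') <= step * INR m / 2 + 2)
    (map (cell m lam) l) (map (cell m lam') l').
Proof.
  intros Hl Hl' Hst Hb. revert l'.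
  induction Hb as [|q l Hq Hb IH]; intros [|q' l'] Hb' Hlen Hn; simpl in *; try easy; constructor.
  - inversion Hb'; subst.
    eapply Rle_trans; [apply (cell_step m lam lam' q q'); try easy|].
    + destruct Hn as [Hn|Hn]; [now left|right; now inversion Hn].
    + pose proof (pos_INR m). nra.
  - inversion Hb'; subst. apply IH; [easy|lia|].
    destruct Hn as [Hn|Hn]; [now left|right; now inversion Hn].
Qed.

(** The combinatorial core, with the contraction schedule [lam] left abstract. In the bound on
    [rho], of the term [3 / INR m], two sides come from [cell_step] and one from the positions
    inside the cubes; [step / 2] is the motion caused by the schedule. *)
Lemma btree_embedding (d h m : nat) (s : nat -> nat) (lam : nat -> R) (j1 : nat) (step Err rho : R)
    (X : list (list R)) :
  (0 < m)%nat ->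
  (forall i, (1 <= i <= h)%nat -> (2 <= s i)%nat) ->
  (forall j, 0 <= lam j <= 1) ->
  (forall j, Rabs (lam j - lam (S j)) <= step) ->
  (forall j, (j1 <= j)%nat -> lam j = 1) -> (j1 < h)%nat ->
  (forall j, (j < h)%nat -> lam j = 0 \/ (m ^ d <= width s j)%nat) ->
  sqrt (INR d) * (step / 2 + 3 / INR m) <= rho ->
  0 <= Err ->
  NoDup X -> length X = btree_size s h ->
  (forall x, In x X -> exists l, (length l = d /\ Forall (fun q => (q < m)%nat) l) /\ in_closed_cube_b (/ INR m) l x = true) ->
  (forall x l l', In x X -> (length l = d /\ Forall (fun q => (q < m)%nat) l) -> length l' = d /\ Forall (fun q => (q < m)%nat) l' ->
     in_closed_cube_b (/ INR m) l x = true -> in_closed_cube_b (/ INR m) l' x = true -> l = l') ->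
  (forall l, (length l = d /\ Forall (fun q => (q < m)%nat) l) ->
     Rabs (INR (m ^ d) * INR (count (in_closed_cube_b (/ INR m) l) X) - INR (btree_size s h))
     <= INR (m ^ d) * Err) ->
  4 * (INR (m ^ d) * (INR (m ^ d) * (INR h + INR (psum (width s) j1) + Err))) <= INR (width s h) ->
  contains_copy_of_btree X rho s h.
Proof.
  intros Hm Hs Hlam Hstep Hlam1 Hj1 Hw0 Hrho HErr Hnd Hlen Hcover Huniq Hcount Hbig.
  set (N := (m ^ d)%nat) in *. assert (HN : (0 < N)%nat) by now apply natpow_pos.
  pose proof (width_pos s h Hs) as Hw.
  set (fits := fun i => in_closed_cube_b (/ INR m) (snake m d i)).
  assert (Hsnake : forall i, (i < N)%nat -> length (snake m d i) = d /\ Forall (fun q => (q < m)%nat) (snake m d i)).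
  { intros i Hi. split; [apply snake_length|now apply snake_bound]. }
  set (ikey := fun v => inner_key m d s lam (length v) (rank s v)).
  set (a := fun i => count (fun v => Nat.eqb (ikey v) i) (upper s h)).
  set (c := fun i => count (fits i) X).
  set (W := width s h) in *. set (D := INR N * (INR h + INR (psum (width s) j1) + Err)) in *.
  assert (HN1 : 1 <= INR N) by (change 1 with (INR 1); now apply le_INR).
  assert (HD : 0 <= D).
  { unfold D. pose proof (pos_INR h). pose proof (pos_INR (psum (width s) j1)). nra. }
  (* Cube [i] holds about [(psum (width s) h + W) / N] points, and about [psum (width s) h / N] of
     them go to non-leaves. The two errors add up to [D]. *)
  assert (Hca : forall i, (i < N)%nat -> Rabs (INR N * (INR (c i) - INR (a i)) - INR W) <= D).
  { intros i Hi. pose proof (Hcount _ (Hsnake i Hi)) as Hc. fold (fits i) in Hc. fold (c i) in Hc.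
    pose proof (count_inner m d s lam h j1 i h Hm Hi Hw Hlam1 (le_n h)) as [H1 H2].
    fold N in H1, H2. change (count _ _) with (a i) in H1, H2. apply le_INR in H1, H2.
    rewrite btree_size_psum in Hc. fold W in Hc.
    rewrite plus_INR, !mult_INR, plus_INR in H1. rewrite plus_INR, !mult_INR, plus_INR in H2.
    rewrite plus_INR in Hc. apply Rabs_le_inv in Hc. unfold D. apply Rabs_le. lra. }
  assert (Hle : forall i, (i < N)%nat -> (a i <= c i)%nat).
  { intros i Hi. specialize (Hca i Hi). apply Rabs_le_inv in Hca. apply INR_le.
    assert (D <= INR W) by nra. apply Rmult_le_reg_l with (INR N); lra. }
  (* The places left free for the leaves. *)
  set (b := fun i => (c i - a i)%nat).
  assert (Hb : forall i, (i < N)%nat -> Rabs (INR N * INR (b i) - INR W) <= D).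
  { intros i Hi. unfold b. rewrite minus_INR by now apply Hle. now apply Hca. }
  assert (Hsum : (W <= psum b N)%nat).
  { pose proof (psum_sub_add a c N Hle) as E. fold b in E.
    pose proof (psum_count_key ikey N (upper s h)) as E1. fold a in E1. rewrite length_upper in E1.
    assert (E2 : (length X <= psum c N)%nat).
    { apply psum_count_ge. intros x Hx. destruct (Hcover x Hx) as [l [[Hl1 Hl2] Hlx]].
      exists (unsnake m l). split.
      - unfold N. rewrite <- Hl1. now apply unsnake_bound.
      - unfold fits. rewrite <- Hl1. now rewrite snake_unsnake. }
    rewrite Hlen, btree_size_psum in E2. fold W in E2. lia. }
  set (key := fun v => if (length v <? h)%nat then ikey v else slot b N (rank s v)).
  assert (Hslot : forall t, (t < W)%nat -> _) by (intros t Ht; exact (slot_scaled b N W t D HD HN Hb Hbig (Nat.lt_le_trans _ _ _ Ht Hsum))).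
  destruct (keyed_injection (list_eq_dec Nat.eq_dec) [] key fits N (btree_vertices s h) X Hnd)
    as [f [Hf Hinj]].
  - intros x i i' Hx Hi Hi' H1 H2.
    rewrite <- (unsnake_snake m d i Hm Hi), <- (unsnake_snake m d i' Hm Hi'). f_equal.
    apply (Huniq x); auto.
  - intros v Hv. apply in_btree in Hv as [Hv1 Hv2]. apply rank_bound in Hv2. unfold key.
    destruct (Nat.ltb_spec (length v) h) as [Hh|Hh].
    + now apply inner_cube.
    + assert (E : length v = h) by lia. rewrite E in Hv2. apply (Hslot _ Hv2).
  - intros i Hi. rewrite btree_upper, count_app.
    rewrite (count_ext _ (fun v => Nat.eqb (ikey v) i) (upper s h)).
    2:{ intros v Hv. apply in_upper in Hv as [Hv _]. unfold key. apply Nat.ltb_lt in Hv. now rewrite Hv. }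
    rewrite (count_ext _ (fun v => Nat.eqb (slot b N (rank s v)) i) (level s h)).
    2:{ intros v Hv. apply level_length in Hv. unfold key. now rewrite Hv, Nat.ltb_irrefl. }
    rewrite (count_level s h (fun _ t => Nat.eqb (slot b N t) i)).
    (* Demand in cube [i] is [a i] from the non-leaves plus at most [b i] from the leaves, in total
       at most [c i]. *)
    pose proof (count_slot_le b N W i Hsum) as H. fold W.
    fold (a i). fold (c i). specialize (Hle i Hi). unfold b in H at 2. lia.
  - exists f. split; [intros u Hu; now apply Hf|]. split; [easy|].
    intros u v Hu Hv [x ->].
    destruct (Hf u Hu) as [Xu Fu]. destruct (Hf _ Hv) as [Xv Fv].
    split; [easy|]. split; [easy|]. split.
    { intros E. apply Hinj in E; [|easy|easy]. apply (f_equal (@length nat)) in E.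
      rewrite length_app in E. simpl in E. lia. }
    apply in_btree in Hu as [Hu1 Hu2]. apply in_btree in Hv as [Hv1 Hv2].
    rewrite length_app in Hv1, Hv2. simpl in Hv1, Hv2. rewrite Nat.add_1_r in Hv1, Hv2.
    apply level_child in Hv2 as Hx. apply rank_bound in Hu2. apply rank_bound in Hv2.
    set (j := length u) in *. set (t := rank s u) in *.
    assert (Et : rank s (u ++ [x]) = (t * s (S j) + x)%nat) by apply rank_child.
    assert (Ej : length (u ++ [x]) = S j) by (rewrite length_app; simpl; fold j; lia).
    unfold key in Fu, Fv. rewrite Ej, Et in Fv. rewrite Et in Hv2.
    unfold ikey in Fu, Fv. rewrite Ej, Et in Fv. fold j t in Fu.
    apply Nat.ltb_lt in Hv1 as Hjh.
    assert (Hb3 : forall B, 0 <= B -> B <= step * INR m / 2 + 2 -> sqrt (INR d) * ((B + 1) / INR m) <= rho).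
    { intros B _ HB. eapply Rle_trans; [|exact Hrho]. apply Rmult_le_compat_l; [apply sqrt_pos|].
      apply lt_0_INR in Hm. apply Rmult_le_reg_r with (INR m); [easy|]. field_simplify; lra. }
    assert (Hst0 : 0 <= step) by (eapply Rle_trans; [apply Rabs_pos|apply (Hstep 0%nat)]).
    assert (HB0 : 0 <= step * INR m / 2) by (pose proof (pos_INR m); nra).
    destruct (inner_cube m d s lam j t Hm (Hlam j) Hu2) as [Ku Cu].
    assert (Hltb : (j <? h)%nat = true) by (apply Nat.ltb_lt; lia). rewrite Hltb in Fu.
    destruct (Nat.ltb_spec (S j) h) as [Hh|Hh].
    + destruct (inner_cube m d s lam (S j) _ Hm (Hlam _) Hv2) as [Kv Cv].
      unfold fits in Fu, Fv. rewrite Cu in Fu. rewrite Cv in Fv.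
      pose proof (scaled_bound N _ _ Hu2 HN) as Bu. pose proof (scaled_bound N _ _ Hv2 HN) as Bv.
      fold N in Fu, Fv.
      eapply Rle_trans; [apply (dist_cubes m _ _ _ _ (step * INR m / 2 + 2) Hm ltac:(lra) Fu Fv)|].
      * apply cells_step; auto; [now apply snake_bound|now apply snake_bound|now rewrite !snake_length|].
        destruct (Hw0 j ltac:(lia)) as [H0|H0]; [now left|right].
        destruct (scaled_step N (width s j) (s (S j)) t x Hx H0 HN) as [S1 S2].
        apply near_snake; auto.
      * rewrite length_map, snake_length. apply Hb3; lra.
    (* The child is a leaf. Its parent has depth [h - 1], which is at least [j1], so the parent lies
       exactly in its target cube. *)
    + assert (Eh : S j = h) by lia.
      assert (Hl1 : lam j = 1) by (apply Hlam1; lia).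
      rewrite inner_key_1 in Fu by easy. fold N in Fu.
      assert (EW : W = (width s j * s (S j))%nat) by (unfold W; now rewrite <- Eh).
      change (width s (S j)) with (width s j * s (S j))%nat in Hv2. rewrite <- EW in Hv2.
      destruct (Hslot _ Hv2) as [K1 [K2 K3]].
      destruct (Hw0 j ltac:(lia)) as [H0|H0]; [lra|].
      rewrite EW in K2, K3.
      destruct (leaf_key_near N (width s j) (s (S j)) t x _ Hx H0 HN K2 K3) as [L1 L2].
      pose proof (scaled_bound N _ _ Hu2 HN) as Bu.
      eapply Rle_trans; [apply (dist_cubes m _ _ _ _ 2 Hm ltac:(lra) Fu Fv)|].
      * apply (near_Rabs 2). apply near_snake; auto.
      * rewrite snake_length. apply Hb3; lra.
Qed.

(** * Large heights *)

Lemma width_growth s h i e : (forall j, (1 <= j <= h)%nat -> (2 <= s j)%nat) ->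
  (i + e <= h)%nat -> (width s i * 2 ^ e <= width s (i + e))%nat.
Proof.
  intros Hs. induction e as [|e IH]; intros He; [rewrite Nat.add_0_r; simpl; lia|].
  rewrite Nat.add_succ_r. cbn [width]. rewrite Nat.pow_succ_r'.
  specialize (IH ltac:(lia)). specialize (Hs (S (i + e)) ltac:(lia)). nia.
Qed.

Lemma psum_width_lt s h n : (forall j, (1 <= j <= h)%nat -> (2 <= s j)%nat) ->
  (n <= h)%nat -> (psum (width s) n < width s n)%nat.
Proof.
  intros Hs. induction n as [|n IH]; intros Hn; simpl; [lia|].
  specialize (IH ltac:(lia)). specialize (Hs (S n) ltac:(lia)). nia.
Qed.

Lemma exp_mono x y : x <= y -> exp x <= exp y.
Proof. intros [H| ->]; [left; now apply exp_increasing|right; easy]. Qed.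

Lemma ln_mono x y : 0 < x -> x <= y -> ln x <= ln y.
Proof. intros Hx [H| ->]; [left; now apply ln_increasing|right; easy]. Qed.

(** Uses [ln 2 > 1/2]. *)
Lemma exp_half_le_pow2 n : exp (INR n / 2) <= INR (2 ^ n).
Proof.
  rewrite pow_INR, <- (Rpower_pow n (INR 2)) by (simpl; lra).
  unfold Rpower. simpl (INR 2). replace (1 + 1) with 2 by ring.
  pose proof ln_lt_2. pose proof (pos_INR n).
  apply exp_mono. nra.
Qed.

(** With [e = c / (k + 1)], the right side is the power [k + 1] of [exp (e * h)], which exceeds
    [e * h]. The one spare factor [h] absorbs [C]. *)
Lemma exp_beats_power (C c : R) (k : nat) : 0 < c ->
  exists H : nat, forall h : nat, (H <= h)%nat -> C * INR h ^ k <= exp (c * INR h).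
Proof.
  intros Hc. set (e := c / INR (S k)).
  assert (Hk : 0 < INR (S k)) by (apply lt_0_INR; lia).
  assert (He : 0 < e) by (apply Rdiv_lt_0_compat; easy).
  assert (Hp : 0 < e ^ S k) by now apply pow_lt.
  destruct (INR_unbounded (C / e ^ S k)) as [H HH].
  exists H. intros h Hh. apply le_INR in Hh. pose proof (pos_INR h) as H0.
  replace (c * INR h) with (INR (S k) * (e * INR h)) by (unfold e; field; lra).
  assert (E : exp (INR (S k) * (e * INR h)) = exp (e * INR h) ^ S k).
  { rewrite <- Rpower_pow by apply exp_pos. unfold Rpower. now rewrite ln_exp. }
  rewrite E. apply Rle_trans with ((e * INR h) ^ S k).
  - rewrite Rpow_mult_distr. cbn [pow].
    assert (C <= e ^ S k * INR h).
    { apply Rmult_le_reg_r with (/ e ^ S k); [now apply Rinv_0_lt_compat|].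
      replace (e ^ S k * INR h * / e ^ S k) with (INR h) by (field; lra).
      unfold Rdiv in HH. lra. }
    pose proof (pow_le (INR h) k H0). cbn [pow] in H1. nra.
  - apply pow_incr. pose proof (exp_ineq1_le (e * INR h)). nra.
Qed.

(** By minimality: if [s ^ (k - 1)] exceeded [16 / eps * h * s], then [k - 1] would already meet
    both conditions. This makes the number of cubes polynomial in [h]. *)
Lemma ks_upper d h eps s k : (1 <= d)%nat -> (1 <= h)%nat -> (2 <= s)%nat -> 0 < eps < 1 ->
  is_ks d h eps s k -> INR (s ^ k) <= 16 / eps * INR h * INR s ^ 2.
Proof.
  intros Hd Hh Hs He [_ Hmin].
  assert (H1 : 1 < / eps) by (rewrite <- Rinv_1; apply Rinv_lt_contravar; lra).
  apply le_INR in Hd, Hh, Hs. simpl in Hd, Hh, Hs.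
  assert (Hsd : 0 < sqrt (INR d)) by (apply sqrt_lt_R0; lra).
  destruct k as [|k].
  - simpl. unfold Rdiv. assert (1 <= INR h * INR s ^ 2) by nra. nra.
  - rewrite Nat.pow_succ_r', mult_INR.
    enough (INR (s ^ k) <= 16 / eps * INR h * INR s) by nra.
    destruct (Rle_or_lt (INR (s ^ k)) (16 / eps * INR h * INR s)) as [H|H]; [easy|exfalso].
    set (q := INR (s ^ k)) in *.
    assert (Hq : 16 * INR h * INR s < eps * q).
    { apply (Rmult_lt_compat_l eps) in H; [|lra].
      replace (eps * (16 / eps * INR h * INR s)) with (16 * INR h * INR s) in H by (field; lra). lra. }
    assert (Hq0 : 0 < q) by nra.
    enough (S k <= k)%nat by lia. apply Hmin. unfold ks_cond, rstar. fold q. split.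
    + apply Rmult_le_reg_r with (q * (2 * INR h)); [nra|].
      replace (sqrt (INR d) * INR s / q * (q * (2 * INR h))) with (sqrt (INR d) * (2 * INR h * INR s))
        by (field; lra).
      replace ((1 + eps) * (sqrt (INR d) / (2 * INR h)) * (q * (2 * INR h)))
        with (sqrt (INR d) * ((1 + eps) * q)) by (field; lra).
      apply Rmult_le_compat_l; nra.
    + apply Rmult_lt_reg_r with (q * (16 * INR h)); [nra|].
      replace (sqrt (INR d) / q * (q * (16 * INR h))) with (sqrt (INR d) * (16 * INR h))
        by (field; lra).
      replace (eps * (sqrt (INR d) / (2 * INR h)) / 8 * (q * (16 * INR h)))
        with (sqrt (INR d) * (eps * q)) by (field; lra).
      apply Rmult_lt_compat_l; nra.
Qed.

Definition clip (x : R) : R := Rmin 1 (Rmax 0 x).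

Lemma clip_bounds x : 0 <= clip x <= 1.
Proof. unfold clip, Rmin, Rmax. repeat destruct Rle_dec; lra. Qed.

Lemma clip_lipschitz x y : Rabs (clip x - clip y) <= Rabs (x - y).
Proof. unfold clip, Rmin, Rmax. repeat destruct Rle_dec; split_Rabs; lra. Qed.

Lemma closed_cell_exists m a : (0 < m)%nat -> 0 <= a <= 1 ->
  exists q, (q < m)%nat /\ INR q * / INR m <= a <= (INR q + 1) * / INR m.
Proof.
  intros Hm Ha. apply lt_0_INR in Hm as Hm'.
  assert (Hs : forall q, INR q <= a * INR m <= INR q + 1 ->
     INR q * / INR m <= a <= (INR q + 1) * / INR m).
  { intros q Hq. split; apply Rmult_le_reg_r with (INR m); auto; field_simplify; lra. }
  destruct (nat_floor (a * INR m) ltac:(nra)) as [H1 H2].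
  set (q := Z.to_nat _) in *. clearbody q.
  destruct (Nat.lt_ge_cases q m) as [Hq|Hq].
  - exists q. split; [easy|]. apply Hs. lra.
  (* Only [a = 1] gets here; it belongs to the last closed cell. *)
  - exists (m - 1)%nat. split; [lia|]. apply Hs. apply le_INR in Hq. rewrite minus_INR by lia. simpl. nra.
Qed.

Lemma closed_cube_exists m x : (0 < m)%nat -> Forall (fun a => 0 <= a <= 1) x ->
  exists l, (length l = length x /\ Forall (fun q => (q < m)%nat) l) /\
            in_closed_cube_b (/ INR m) l x = true.
Proof.
  intros Hm. induction 1 as [|a x Ha _ [l [[IH1 IH2] IH3]]].
  - exists []. repeat split. constructor.
  - destruct (closed_cell_exists m a Hm Ha) as [q [Hq Hqa]].
    exists (q :: l). split; [split; [simpl; lia|now constructor]|].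
    apply in_closed_cube_bP. constructor; [easy|]. now apply in_closed_cube_bP.
Qed.

Lemma open_cube_unique s k l l' x : (0 < s)%nat ->
  in_open_cube s k l x -> in_open_cube s k l' x -> l = l'.
Proof.
  intros Hs H. revert l'. induction H as [|q a l x Hq _ IH]; intros l' H'; inversion H'; subst; [easy|].
  f_equal; [|now apply IH].
  assert (0 < side s k) by (apply Rinv_0_lt_compat, lt_0_INR, natpow_pos; easy).
  assert (INR q < INR x0 + 1) by (apply Rmult_lt_reg_r with (side s k); lra).
  assert (INR x0 < INR q + 1) by (apply Rmult_lt_reg_r with (side s k); lra).
  assert (q < S x0)%nat by (apply INR_lt; rewrite S_INR; lra).
  assert (x0 < S q)%nat by (apply INR_lt; rewrite S_INR; lra). lia.
Qed.

(** Instantiates [btree_embedding] with an explicit schedule; the asymptotics in [h] enter only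
    through two numerical inequalities. Points off the boundary lie in the open cubes, which are
    disjoint, so each point has a unique cube. *)
Lemma btree_embedding_large (d h : nat) (eps : R) (seqs : nat -> nat) (s k : nat) (X : list (list R)) :
  (1 <= d)%nat -> 0 < eps < 1 -> 6 <= eps * INR h -> (2 <= s)%nat ->
  (forall i, (1 <= i <= h)%nat -> (2 <= seqs i)%nat) ->
  ks_cond d h eps s k ->
  24 * INR ((s ^ k) ^ d) ^ 2 * INR h <= exp (eps / 24 * INR h) ->
  NoDup X ->
  length X = btree_size seqs h ->
  (forall x, In x X -> in_unit_cube d x /\ ~ on_boundary d s k x) ->
  (forall q, cube_index d s k q ->
     INR (btree_size seqs h) / INR (s ^ (k * d))
       - Rpower (INR (btree_size seqs h)) (2 / 3)
     <= INR (count_in_cube s k q X) <=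
     INR (btree_size seqs h) / INR (s ^ (k * d))
       + Rpower (INR (btree_size seqs h)) (2 / 3)) ->
  contains_copy_of_btree X ((1 + eps) * rstar d h) seqs h.
Proof.
  intros Hd He Hh Hs Hseqs [_ Hside] Hbig Hnd Hlen HX Hcount.
  set (m := (s ^ k)%nat) in *. set (N := (m ^ d)%nat) in *.
  assert (Hm : (0 < m)%nat) by (apply natpow_pos; lia).
  assert (HN : (0 < N)%nat) by now apply natpow_pos.
  assert (Hm0 : 0 < INR m) by now apply lt_0_INR.
  assert (HN1 : 1 <= INR N) by (change 1 with (INR 1); now apply le_INR).
  assert (Hh6 : 6 < INR h) by nra.
  assert (Hh0 : (1 <= h)%nat) by (apply INR_le; simpl; lra).
  (* A lower bound for the growth of the width over any [eps * h / 12] consecutive layers, as each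
     layer at least doubles. *)
  set (Y := exp (eps / 24 * INR h)) in *. assert (HY : 0 < Y) by apply exp_pos.
  set (W := width seqs h). set (n := btree_size seqs h) in *.
  destruct (nat_floor ((1 - eps / 4) * INR h) ltac:(nra)) as [F1 F2].
  set (j1 := S (Z.to_nat (Int_part ((1 - eps / 4) * INR h)))).
  assert (J : (1 - eps / 4) * INR h < INR j1 <= (1 - eps / 4) * INR h + 1)
    by (unfold j1; rewrite S_INR; lra).
  assert (Hj1 : (j1 < h)%nat) by (apply INR_lt; lra).
  assert (Hpow : forall e, eps * INR h / 12 <= INR e -> Y <= INR (2 ^ e)).
  { intros e H. eapply Rle_trans; [|apply exp_half_le_pow2]. apply exp_mono. lra. }
  assert (Hwidth : forall j, (j <= h)%nat -> (2 ^ j <= width seqs j)%nat).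
  { intros j Hj. pose proof (width_growth seqs h 0 j Hseqs Hj). simpl in H. lia. }
  assert (HYW : Y <= INR W).
  { eapply Rle_trans; [apply (Hpow h); nra|]. apply le_INR, Hwidth. lia. }
  assert (HW : 0 < INR W) by lra.
  assert (HnW : INR W <= INR n <= 2 * INR W).
  { unfold n. rewrite btree_size_psum, plus_INR. fold W.
    pose proof (psum_width_lt seqs h h Hseqs (le_n h)) as H. apply lt_INR in H. fold W in H.
    pose proof (pos_INR (psum (width seqs) h)). lra. }
  assert (HS : INR (psum (width seqs) j1) * Y <= INR W).
  { pose proof (psum_width_lt seqs h j1 Hseqs ltac:(lia)) as H1. apply lt_INR in H1.
    pose proof (width_growth seqs h j1 (h - j1) Hseqs ltac:(lia)) as H2.
    replace (j1 + (h - j1))%nat with h in H2 by lia. apply le_INR in H2. fold W in H2.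
    rewrite mult_INR in H2.
    (* Here [h - j1 >= eps * h / 4 - 1 >= eps * h / 12], which is where [6 <= eps * h] is needed. *)
    assert (H3 : Y <= INR (2 ^ (h - j1))) by (apply Hpow; rewrite minus_INR by lia; lra).
    pose proof (pos_INR (psum (width seqs) j1)). nra. }
  set (Err := Rpower (INR n) (2 / 3)) in *.
  assert (HErr0 : 0 < Err) by apply exp_pos.
  assert (HErr : Err * Y <= 2 * INR W).
  { apply Rle_trans with (Err * Rpower (INR n) (/ 3)).
    - apply Rmult_le_compat_l; [lra|]. unfold Rpower. apply exp_mono.
      assert (INR h / 2 <= ln (INR n)); [|nra].
      rewrite <- (ln_exp (INR h / 2)).
      assert (E : exp (INR h / 2) <= INR n).
      { eapply Rle_trans; [apply exp_half_le_pow2|]. eapply Rle_trans; [apply le_INR, (Hwidth h); lia|apply HnW]. }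
      apply ln_mono; [apply exp_pos|easy].
    - unfold Err. rewrite <- Rpower_plus. replace (2 / 3 + / 3) with 1 by field.
      rewrite Rpower_1; lra. }
  set (lam := fun j : nat => clip ((INR j - eps * INR h / 12) * ((1 + eps / 2) / INR h))).
  set (step := (1 + eps / 2) / INR h).
  assert (Hst : 0 < step) by (apply Rdiv_lt_0_compat; lra).
  assert (Hsth : step * INR h = 1 + eps / 2) by (unfold step; field; lra).
  apply (btree_embedding d h m seqs lam j1 step Err); try assumption.
  - intros j. apply clip_bounds.
  - intros j. unfold lam. eapply Rle_trans; [apply clip_lipschitz|].
    fold step. rewrite S_INR. apply Rabs_le. nra.
  - intros j Hj. apply le_INR in Hj. unfold lam. fold step.
    assert (1 <= (INR j - eps * INR h / 12) * step).
    (* The ramp is complete by [j1]: [1 - eps/4 - eps/12 = 1 - eps/3], and [(1 - eps/3) * (1 +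
       eps/2) = 1 + eps * (1 - eps) / 6]. *)
    { apply Rle_trans with ((1 - eps / 3) * INR h * step).
      - rewrite Rmult_assoc, (Rmult_comm (INR h)), Hsth. nra.
      - apply Rmult_le_compat_r; lra. }
    unfold clip. rewrite Rmax_right, Rmin_left; lra.
  (* Up to depth [eps * h / 12] everything stays in the central cube; afterwards the width is at
     least [Y], hence at least [N]. *)
  - intros j Hj. destruct (Rle_or_lt (INR j) (eps * INR h / 12)) as [H|H].
    + left. unfold lam. fold step. unfold clip. rewrite Rmax_left by nra. apply Rmin_right. lra.
    + right. fold N. apply INR_le. apply Rle_trans with Y; [nra|].
      eapply Rle_trans; [apply (Hpow j); lra|]. apply le_INR, Hwidth. lia.
  (* The schedule uses [(1 + eps/2) * rstar] of the radius, and three cube diameters use less than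
     [3/8 * eps * rstar]. *)
  - assert (E : sqrt (INR d) * (step / 2) = (1 + eps / 2) * rstar d h)
      by (unfold step, rstar; field; lra).
    assert (E2 : sqrt (INR d) * (3 / INR m) = 3 * (sqrt (INR d) / INR m)) by (field; lra).
    assert (0 <= rstar d h).
    { apply Rmult_le_pos; [apply sqrt_pos|]. left. apply Rinv_0_lt_compat. lra. }
    rewrite Rmult_plus_distr_l, E, E2. nra.
  - lra.
  - intros x Hx. destruct (HX x Hx) as [[Hxd Hx01] _].
    rewrite <- Hxd. now apply closed_cube_exists.
  - intros x l l' Hx Hl Hl' H1 H2. destruct (HX x Hx) as [_ Hbd].
    assert (Hopen : forall l, cube_index d s k l -> in_closed_cube_b (/ INR m) l x = true -> in_open_cube s k l x).
    { intros l0 Hl0 H0. apply NNPP. intros Hno. apply Hbd. exists l0.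
      split; [easy|split; [|easy]]. now apply in_closed_cube_bP. }
    apply (open_cube_unique s k l l' x); [lia| |]; apply Hopen; easy.
  - intros l Hl. specialize (Hcount l Hl).
    change (count_in_cube s k l X) with (count (in_closed_cube_b (/ INR m) l) X) in Hcount.
    rewrite Nat.pow_mul_r in Hcount. fold m N in Hcount. fold N.
    change (length l = d /\ Forall (fun q => (q < m)%nat) l) in Hl. fold n.
    set (c := INR (count _ _)) in *. clearbody c. destruct Hcount as [C1 C2].
    apply (Rmult_le_compat_l (INR N)) in C1, C2; try lra.
    assert (E : INR N * (INR n / INR N) = INR n) by (field; lra).
    apply Rabs_le. lra.
  (* The three terms are at most [W/6], [W/6] and [W/3]. *)
  - fold N W. set (S1 := INR (psum (width seqs) j1)) in *.
    set (q := INR N * INR N) in *.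
    assert (Hq : 24 * q * INR h <= Y) by (unfold q; lra).
    assert (Hq0 : 1 <= q) by (unfold q; nra).
    assert (Hq1 : 24 * q <= Y) by nra.
    assert (A1 : 24 * q * S1 <= INR W).
    { apply Rle_trans with (S1 * Y); [|easy]. rewrite Rmult_comm.
      apply Rmult_le_compat_l; [apply pos_INR|easy]. }
    assert (A2 : 24 * q * Err <= 2 * INR W).
    { apply Rle_trans with (Err * Y); [|easy]. rewrite Rmult_comm.
      apply Rmult_le_compat_l; lra. }
    replace (4 * (INR N * (INR N * (INR h + S1 + Err)))) with (4 * q * INR h + 4 * q * S1 + 4 * q * Err)
      by (unfold q; ring). lra.
Qed.

Theorem theorem3p2 (M : nat -> nat)
  (HM2 : forall h : nat, (1 <= h)%nat -> (2 <= M h)%nat)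
  (HMo : forall c : R, 0 < c -> exists H : nat, forall h : nat, (H <= h)%nat ->
           INR (M h) <= c * (INR h / ln (INR h))) :
  forall (d : nat) (eps : R), (1 <= d)%nat -> 0 < eps < 1 ->
  exists h0 : nat, forall h : nat, (h0 <= h)%nat ->
  forall K : nat -> nat,
    (forall s, (2 <= s <= M h)%nat -> is_ks d h eps s (K s)) ->
  let m' := (d * K 2%nat * M h)%nat in
  (m' <= h)%nat /\
  forall (seqs : nat -> nat),
    (forall i, (1 <= i <= h)%nat -> (2 <= seqs i <= M h)%nat) ->
  forall (s : nat),
    (2 <= s <= M h)%nat ->
    (d * K 2%nat <= occurrences seqs m' s)%nat ->
  forall (X : list (list R)),
    NoDup X ->
    length X = btree_size seqs h ->
    (forall x, In x X -> in_unit_cube d x /\ ~ on_boundary d s (K s) x) ->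
    (forall q, cube_index d s (K s) q ->
       INR (btree_size seqs h) / INR (s ^ (K s * d))
         - Rpower (INR (btree_size seqs h)) (2 / 3)
       <= INR (count_in_cube s (K s) q X) <=
       INR (btree_size seqs h) / INR (s ^ (K s * d))
         + Rpower (INR (btree_size seqs h)) (2 / 3)) ->
    contains_copy_of_btree X ((1 + eps) * rstar d h) seqs h.
Proof.
  intros d eps Hd He.
  assert (Hd1 : 1 <= INR d) by (change 1 with (INR 1); now apply le_INR).
  (* The constant matches the bound [K 2 <= 4 * ln h] below, so that [d * K 2 * M h <= h]. *)
  destruct (HMo (/ (4 * INR d)) ltac:(apply Rinv_0_lt_compat; lra)) as [H1 HH1].
  (* Since [s ^ K s] is at most [16 / eps * h ^ 3], the quantity [N ^ 2 * h] has degree [6 * d + 1]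
     in [h]. *)
  destruct (exp_beats_power (24 * ((16 / eps) ^ d) ^ 2) (eps / 24) (6 * d + 1) ltac:(lra)) as [H2 HH2].
  destruct (INR_unbounded (64 / eps)) as [H3 HH3].
  exists (Nat.max H1 (Nat.max H2 H3)). intros h Hh K HK m'.
  specialize (HH1 h ltac:(lia)). specialize (HH2 h ltac:(lia)).
  assert (Hh3 : 64 / eps < INR h) by (apply Rlt_le_trans with (INR H3); [easy|apply le_INR; lia]).
  assert (Heh : 64 < eps * INR h).
  { apply (Rmult_lt_compat_l eps) in Hh3; [|lra]. replace (eps * (64 / eps)) with 64 in Hh3 by (field; lra). lra. }
  assert (Hh64 : 64 < INR h) by nra.
  assert (Hh1 : (1 <= h)%nat) by (apply INR_le; simpl; lra).
  assert (Hln : 1 <= ln (INR h)).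
  { rewrite <- (ln_exp 1). left. apply ln_increasing; [apply exp_pos|]. pose proof exp_le_3. lra. }
  assert (HMln : INR (M h) * (4 * INR d * ln (INR h)) <= INR h).
  { apply (Rmult_le_compat_r (4 * INR d * ln (INR h))) in HH1; [|nra].
    replace (/ (4 * INR d) * (INR h / ln (INR h)) * (4 * INR d * ln (INR h))) with (INR h) in HH1
      by (field; lra). easy. }
  split.
  - pose proof (ks_upper d h eps 2 (K 2%nat) Hd Hh1 (le_n 2) He (HK 2%nat (conj (le_n 2) (HM2 h Hh1)))) as Hk.
    (* From [2 ^ K 2 <= 64 / eps * h <= h ^ 2]; the threshold [64 / eps] on [h] gives the last
       inequality. *)
    assert (Hk2 : INR (K 2%nat) / 2 <= 2 * ln (INR h)).
    { replace (2 * ln (INR h)) with (ln (INR h * INR h)) by (rewrite ln_mult; lra).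
      rewrite <- (ln_exp (INR (K 2%nat) / 2)).
      assert (E : exp (INR (K 2%nat) / 2) <= INR h * INR h).
      { eapply Rle_trans; [apply exp_half_le_pow2|]. eapply Rle_trans; [exact Hk|].
        simpl. replace (16 / eps * INR h * ((1 + 1) * ((1 + 1) * 1))) with (64 / eps * INR h) by (field; lra). nra. }
      apply ln_mono; [apply exp_pos|easy]. }
    apply INR_le. unfold m'. rewrite !mult_INR. eapply Rle_trans; [|exact HMln].
    pose proof (pos_INR (M h)).
    apply Rle_trans with (INR d * (4 * ln (INR h)) * INR (M h)); [|right; ring].
    apply Rmult_le_compat_r; [easy|]. apply Rmult_le_compat_l; lra.
  - intros seqs Hseqs s Hs _ X Hnd Hlen HX Hcount.
    apply (btree_embedding_large d h eps seqs s (K s) X); try assumption; try lra; try lia.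
    + intros i Hi. now apply Hseqs.
    + apply (HK s Hs).
    + eapply Rle_trans; [|exact HH2].
      pose proof (ks_upper d h eps s (K s) Hd Hh1 ltac:(lia) He (HK s Hs)) as Hk.
      assert (Hsh : INR s <= INR h).
      { apply Rle_trans with (INR (M h)); [apply le_INR; lia|]. pose proof (pos_INR (M h)).
        assert (1 <= 4 * INR d * ln (INR h)) by nra. nra. }
      assert (Hq : INR (s ^ K s) <= 16 / eps * INR h ^ 3).
      { eapply Rle_trans; [exact Hk|].
        replace (16 / eps * INR h ^ 3) with (16 / eps * INR h * INR h ^ 2) by ring.
        apply Rmult_le_compat_l.
        - apply Rmult_le_pos; [|lra]. apply Rlt_le, Rdiv_lt_0_compat; lra.
        - apply pow_incr. split; [apply pos_INR|easy]. }
      rewrite pow_INR.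
      assert (HQ : INR (s ^ K s) ^ d <= (16 / eps) ^ d * INR h ^ (3 * d)).
      { rewrite pow_mult, <- Rpow_mult_distr. apply pow_incr. split; [apply pos_INR|easy]. }
      assert (HQ2 : (INR (s ^ K s) ^ d) ^ 2 <= ((16 / eps) ^ d * INR h ^ (3 * d)) ^ 2).
      { apply pow_incr. split; [apply pow_le, pos_INR|easy]. }
      replace (24 * ((16 / eps) ^ d) ^ 2 * INR h ^ (6 * d + 1))
        with (24 * ((16 / eps) ^ d * INR h ^ (3 * d)) ^ 2 * INR h).
      2:{ rewrite pow_add, pow_1. replace (6 * d)%nat with (3 * d * 2)%nat by lia.
          rewrite (pow_mult (INR h) (3 * d) 2). ring. }
      apply Rmult_le_compat_r; lra.
Qed.
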